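(* For every positive integer $x$ and every integer $n\ge 2$, \[ \alpha^{(n)}_{\mathfrak{p}}(x)=P_{\alpha^{(n-1)}_{\mathfrak{p}}(x)}; \] equivalently, $\alpha^{(n)}_{\mathfrak{p}}(x)=P_{P_{\cdots P_x}}$, the iterated prime index.
   Context: Let $P_k$ denote the $k$th prime number ($P_1=2$, $P_2=3,\dots$). The generalized ($n$th-degree) primorial is defined by $\mathfrak{p}^{(0)}(P_k)=P_k$ and, for $n\ge 1$ and positive integers $x$, $\mathfrak{p}^{(n)}(x)=\prod_{k=1}^{x}\mathfrak{p}^{(n-1)}(P_k)$; thus $\mathfrak{p}^{(1)}(x)=P_1P_2\cdots P_x$ is the usual primorial. Let $\omega(m)$ denote the number of distinct prime factors of $m$, and define $\alpha^{(n)}_{\mathfrak{p}}(x)=\omega(\mathfrak{p}^{(n)}(x))$. *)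

(* Defs.v *)
From mathcomp Require Import all_boot.

Set Implicit Arguments.
Unset Strict Implicit.
Unset Printing Implicit Defensive.

Lemma ex_prime_gt (m : nat) : exists p, (m < p) && prime p.
Proof. by have [p lt_mp pr_p] := prime_above m; exists p; rewrite lt_mp. Qed.

Definition next_prime (m : nat) : nat := ex_minn (ex_prime_gt m).

(* P_k, indexed from 1: P_1 = 2, P_2 = 3, and so on; nth_prime 0 = 0 is a
   dummy value. *)
Definition nth_prime (k : nat) : nat := iter k next_prime 0.

Definition omega (m : nat) : nat := size (primes m).

(* Degree 0 is only meant to be evaluated at primes, where it is the identity;
   taking it to be the identity everywhere does not affect higher degrees,
   which only use it at the P_k. *)
Fixpoint gprimorial (n x : nat) : nat :=
  if n is n'.+1 then \prod_(1 <= k < x.+1) gprimorial n' (nth_prime k) else x.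

Definition alpha (n x : nat) : nat := omega (gprimorial n x).

(* Main.v *)
Require Import Defs.
From mathcomp Require Import all_boot.

(** For n >= 1 the prime divisors of [gprimorial n x] are exactly the primes
    P_1, ..., P_m with m the (n-1)-fold iterate of P at x: by induction on n the
    factors of the defining product have initial segments of the primes as their
    sets of prime divisors, and by monotonicity the factor k = x has the
    longest one. *)

Lemma next_prime_gt (m : nat) : m < next_prime m.
Proof. by rewrite /next_prime; case: ex_minnP => p /andP[]. Qed.

Lemma prime_next_prime (m : nat) : prime (next_prime m).
Proof. by rewrite /next_prime; case: ex_minnP => p /andP[]. Qed.

Lemma prime_nth_prime (k : nat) : 0 < k -> prime (nth_prime k).
Proof. by case: k => // k _; apply: prime_next_prime. Qed.

Lemma nth_prime_gt0 (k : nat) : 0 < k -> 0 < nth_prime k.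
Proof. by move/prime_nth_prime/prime_gt0. Qed.

Lemma leq_nth_prime : {mono nth_prime : i j / i <= j}.
Proof.
by apply/leq_mono/(homo_ltn ltn_trans) => k; apply: next_prime_gt.
Qed.

Lemma nth_prime_inj : injective nth_prime.
Proof. by move=> i j /eqP; rewrite eqn_leq !leq_nth_prime -eqn_leq => /eqP. Qed.

Lemma leq_iter_nth_prime (n : nat) : {mono iter n nth_prime : i j / i <= j}.
Proof. by elim: n => //= n IHn i j; rewrite leq_nth_prime IHn. Qed.

(** Positivity matters because [primes 0] is empty although every prime divides 0. *)
Lemma gprimorial_gt0 (n x : nat) : 0 < x -> 0 < gprimorial n x.
Proof.
elim: n x => //= n IHn x _; rewrite big_nat_cond.
by apply: prodn_cond_gt0 => k /andP[/andP[k_gt0 _] _]; apply/IHn/nth_prime_gt0.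
Qed.

(** Euclid's lemma, applied to the defining product. *)
Lemma dvdn_gprimorialS (n x p : nat) : prime p ->
  reflect (exists2 k, 0 < k <= x & p %| gprimorial n (nth_prime k))
          (p %| gprimorial n.+1 x).
Proof.
move=> p_pr; rewrite /= Euclid_dvd_prod // big_has_cond.
apply: (iffP hasP) => [[k] | [k k_in pk]].
  by rewrite mem_index_iota ltnS /= => k_in pk; exists k.
by exists k => //; rewrite mem_index_iota ltnS.
Qed.

Lemma dvdn_gprimorial (n x p : nat) : 0 < x -> prime p ->
  (p %| gprimorial n.+1 x) <->
  exists2 j, 0 < j <= iter n nth_prime x & p = nth_prime j.
Proof.
move=> x_gt0 p_pr; elim: n x x_gt0 => [|n IHn] x x_gt0.
  split=> [/(dvdn_gprimorialS _ _ _ p_pr)[k k_in] | [j j_in ->]].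
    (* In degree 0 the factor is the prime P_k itself, so [p] must equal it. *)
    rewrite /= dvdn_prime2 ?prime_nth_prime //; last by case/andP: k_in.
    by move/eqP; exists k.
  apply/dvdn_gprimorialS; last by exists j.
  by apply: prime_nth_prime; case/andP: j_in.
split=> [/(dvdn_gprimorialS _ _ _ p_pr)[k /andP[k_gt0 le_kx]] | [j j_in def_p]].
  case/IHn=> [|j /andP[j_gt0 le_j] def_p]; first exact: nth_prime_gt0.
  exists j => //; rewrite j_gt0 iterSr (leq_trans le_j) //.
  by rewrite leq_iter_nth_prime leq_nth_prime.
(* The last factor suffices: its bound, [n] iterations from P_x, is [n.+1] iterations from [x]. *)
apply/dvdn_gprimorialS => //; exists x; first by rewrite x_gt0 leqnn.
by apply/IHn; [apply: nth_prime_gt0 | exists j; rewrite -?iterSr].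
Qed.

Lemma alphaS (n x : nat) : 0 < x -> alpha n.+1 x = iter n nth_prime x.
Proof.
move=> x_gt0; rewrite /alpha /omega.
(* By injectivity of [nth_prime], counting the prime divisors amounts to counting their indices. *)
have /perm_size-> : perm_eq (primes (gprimorial n.+1 x))
                            (map nth_prime (iota 1 (iter n nth_prime x))).
  apply: uniq_perm; first exact: primes_uniq.
    by rewrite (map_inj_uniq nth_prime_inj) iota_uniq.
  move=> p; rewrite mem_primes gprimorial_gt0 //=.
  apply/andP/mapP=> [[p_pr /dvdn_gprimorial[] // j j_in ->] | [j]].
    by exists j; rewrite // mem_iota add1n ltnS.
  rewrite mem_iota add1n ltnS => j_in ->.
  have p_pr : prime (nth_prime j) by apply: prime_nth_prime; case/andP: j_in.
  by split=> //; apply/dvdn_gprimorial => //; exists j.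
by rewrite size_map size_iota.
Qed.

Theorem theorem6p6 (n x : nat) (hn : 2 <= n) (hx : 0 < x) :
  alpha n x = nth_prime (alpha (n - 1) x) /\
  alpha n x = iter (n - 1) nth_prime x.
(* As [2 <= n], [alphaS] applies in degrees [n] and [n - 1]; the two iterates differ by one outer
   [nth_prime]. *)
Proof. by case: n hn => [|[|n]] // _; rewrite subn1 /= !alphaS. Qed.
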